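(* Let $f\in\mathbb{Q}(x)$ have degree 4. If $f=g\circ h$ with $g,h\in\overline{\mathbb{Q}}(x)$, then there exist a field $\mathbb{K}$ with $\mathbb{Q}\subseteq\mathbb{K}\subseteq\overline{\mathbb{Q}}$ and a unit $u\in\overline{\mathbb{Q}}(x)$ such that $g\circ u^{-1}\in\mathbb{K}(x)$, $u\circ h\in\mathbb{K}(x)$ and $[\mathbb{K}:\mathbb{Q}]\leq 3$.
   Context: $\overline{\mathbb{Q}}$ is an algebraic closure of $\mathbb{Q}$. The degree of a non-constant rational function $f=f_N/f_D$ with $f_N,f_D$ coprime polynomials is $\max\{\deg f_N,\deg f_D\}$. The units of $L(x)$ with respect to composition ($L$ a field) are the Möbius transformations $(ax+b)/(cx+d)$ with $a,b,c,d\in L$, $ad-bc\neq0$; $u^{-1}$ denotes the inverse of $u$ with respect to composition. *)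

(* Defs.v *)
From HB Require Import structures.
From mathcomp Require Import all_boot all_order all_algebra all_field.

Set Implicit Arguments.
Unset Strict Implicit.
Unset Printing Implicit Defensive.

Import GRing.Theory.
Local Open Scope ring_scope.

(* Rational functions in one variable over F. *)
Notation ratfun F := {fraction {poly F}}.

Notation "x %:F" := (@FracField.tofrac _ x) : ring_scope.

Section RatFun.
Variable F : fieldType.
Implicit Types (f g h u v : ratfun F) (p : {poly F}).

(* The representative [repr f] chosen by the quotient type need not be in
   lowest terms; dividing by the gcd gives the coprime pair f_N, f_D, unique up
   to a common nonzero constant factor. *)
Definition rf_num f : {poly F} :=
  let r := repr f in \n_r %/ gcdp \n_r \d_r.

Definition rf_den f : {poly F} :=
  let r := repr f in \d_r %/ gcdp \n_r \d_r.

Lemma rf_den_neq0 f : rf_den f != 0.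
Proof.
by rewrite /rf_den divpN0 ?dvdp_leq ?denom_ratioP ?dvdp_gcdr //
  gcdp_eq0 negb_and denom_ratioP orbT.
Qed.

Lemma rf_coprime f : coprimep (rf_num f) (rf_den f).
Proof. by rewrite coprimep_div_gcd // denom_ratioP orbT. Qed.

Lemma rf_numdenE f : f = (rf_num f)%:F / (rf_den f)%:F.
Proof.
have den0 : (rf_den f)%:F != 0 by rewrite tofrac_eq0 rf_den_neq0.
apply: (canRL (mulfK den0)).
rewrite -[f in f * _]reprK /rf_den /rf_num; set r := repr f.
have g0 : gcdp \n_r \d_r != 0 by rewrite gcdp_eq0 negb_and denom_ratioP orbT.
have pi_r : \pi_(ratfun F)%qT r * (\d_r)%:F = (\n_r)%:F.
  unlock FracField.tofrac; rewrite -[LHS]FracField.pi_mul.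
  apply/eqmodP; rewrite /= FracField.equivfE /FracField.mulf.
  by rewrite !numden_Ratio ?mulr1 ?oner_neq0 ?denom_ratioP // mulrC.
apply: (mulIf (x := (gcdp \n_r \d_r)%:F)); first by rewrite tofrac_eq0.
by rewrite -mulrA -!tofracM !divpK ?dvdp_gcdl ?dvdp_gcdr.
Qed.

(* Since [size p = deg p + 1] for p != 0, this is max (deg f_N) (deg f_D); a
   constant f, including f = 0, gets the value 0. *)
Definition rf_degree f : nat := (maxn (size (rf_num f)) (size (rf_den f))).-1.

Definition rf_eval p h : ratfun F := (map_poly (fun c => c%:P%:F) p).[h].

(* g \o h.  As division by 0 gives 0, the value is 0 by convention in the only
   case where the composite does not exist: h constant, equal to a pole of g. *)
Definition rf_comp g h : ratfun F := rf_eval (rf_num g) h / rf_eval (rf_den g) h.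

Definition rf_X : ratfun F := 'X%:F.

Definition rf_unit u : Prop :=
  exists a b c d : F, a * d - b * c != 0 /\
    u = (a *: 'X + b%:P)%:F / (c *: 'X + d%:P)%:F.

Definition rf_comp_inverse u v : Prop :=
  rf_comp u v = rf_X /\ rf_comp v u = rf_X.

End RatFun.

Arguments rf_X {F}.

(* The map F(x) -> L(x) applying a field morphism phi : F -> L to the
   coefficients. *)
Definition rf_map (F L : fieldType) (phi : F -> L) (f : ratfun F) : ratfun L :=
  (map_poly phi (rf_num f))%:F / (map_poly phi (rf_den f))%:F.

(* For K embedded in L by phi: f belongs to K(x). *)
Definition rf_defined_over (K L : fieldType) (phi : K -> L) (f : ratfun L) :
  Prop := exists f0 : ratfun K, f = rf_map phi f0.

(* Main.v *)
(* Degrees multiply, so (deg g, deg h) is (4,1), (1,4) or (2,2).  In the first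
   two cases [u = h^-1], resp. [u = g], works over Q.  If both degrees are 2, the
   choice of [u] amounts to a choice of basis (H, T) of the pencil spanned by
   h_N and h_D; in reduced echelon form it is (X^2 - c, X + b) or (X^2 + c X, 1).
   Then f_N and f_D are quadratic forms in H, T, and their coefficients in
   degrees 4, 3, 2 determine those of the forms, rationally in b and c, so it
   remains to bound the degree of Q(b, c).  The two lowest coefficients of f_N
   and f_D give equations for b and c that are linear in the coefficients
   ([quad_rel]), hence are satisfied by every rational combination of f_N and
   f_D.  For a combination E of degree at most 3, which exists, they say either
   that c is in Q(b) and E(-b) = 0, or, if E has degree less than 3, that b is
   rational; then a combination of degree 4 makes c quadratic.  In the second
   echelon form c is rational. *)

Require Import Defs.
From mathcomp Require Import all_boot all_order all_algebra all_field.
From mathcomp Require Import ring zify.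

Set Implicit Arguments.
Unset Strict Implicit.
Unset Printing Implicit Defensive.

Import GRing.Theory.
Local Open Scope ring_scope.

Lemma divf_cancelr (K : fieldType) (x y z : K) :
  z != 0 -> (x / z) / (y / z) = x / y.
Proof. by move=> z0; rewrite invf_div mulrA divfK. Qed.

Lemma divf_cancell (K : fieldType) (x y z : K) :
  z != 0 -> (z * x) / (z * y) = x / y.
Proof. by move=> z0; rewrite -mulf_div divff ?mul1r. Qed.

(** * Fractions in lowest terms, and composition through homogenized polynomials *)

Section Fractions.
Variable F : fieldType.
Implicit Types (p q r s : {poly F}) (f g h : ratfun F).

Lemma tofrac_div_eq p q r s :
  q != 0 -> s != 0 -> (p%:F / q%:F == r%:F / s%:F) = (p * s == r * q).
Proof.
by move=> q0 s0; rewrite eqr_div ?tofrac_eq0 // -!tofracM tofrac_eq.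
Qed.

Lemma coprimep_frac_uniq p q r s :
    q != 0 -> s != 0 -> coprimep p q -> coprimep r s ->
    p%:F / q%:F = r%:F / s%:F ->
  exists2 k, k != 0 & p = k *: r /\ q = k *: s.
Proof.
move=> q0 s0 cpq crs /eqP; rewrite tofrac_div_eq // => /eqP e.
have dqs : q %| s by rewrite -(Gauss_dvdpr _ (_ : coprimep q p)) 1?coprimep_sym // e dvdp_mull.
have dsq : s %| q by rewrite -(Gauss_dvdpr _ (_ : coprimep s r)) 1?coprimep_sym // -e dvdp_mull.
have /eqpf_eq [k k0 qE] : q %= s by rewrite /eqp dqs dsq.
exists k => //; split=> //; apply: (mulIf s0).
by rewrite e qE -scalerAr scalerAl.
Qed.

(** [rf_num] and [rf_den] come from a chosen representative, so a coprime pair is recovered only up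
    to a scalar k; sizes and quotients do not see it. *)
Lemma rf_numden_frac p q : q != 0 -> coprimep p q ->
  exists2 k, k != 0 &
    rf_num (p%:F / q%:F) = k *: p /\ rf_den (p%:F / q%:F) = k *: q.
Proof.
move=> q0 cpq; apply: coprimep_frac_uniq; rewrite ?rf_den_neq0 ?rf_coprime //.
by rewrite -rf_numdenE.
Qed.

Lemma rf_degree_frac p q : q != 0 -> coprimep p q ->
  rf_degree (p%:F / q%:F) = (maxn (size p) (size q)).-1.
Proof.
by move=> q0 /(rf_numden_frac q0)[k k0 [np dq]]; rewrite /rf_degree np dq !size_scale.
Qed.

(* The homogenization of p in degree n, evaluated at (r, s). *)
Definition homog n p r s : {poly F} :=
  \sum_(k < n.+1) p`_k *: (r ^+ k * s ^+ (n - k)).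

Lemma homogZ n k p r s : homog n (k *: p) r s = k *: homog n p r s.
Proof.
by rewrite scaler_sumr; apply: eq_bigr => i _; rewrite coefZ scalerA.
Qed.

(** Each r^k / s^k is written as r^k s^(n-k) / s^n. Since n only bounds the degree, the numerator
    and denominator of g can share it, and s^n cancels in [rf_comp_frac]. *)
Lemma rf_eval_frac n p r s : (size p <= n.+1)%N -> s != 0 ->
  rf_eval p (r%:F / s%:F) = (homog n p r s)%:F / s%:F ^+ n.
Proof.
move=> sp s0; have s0' : s%:F != 0 by rewrite tofrac_eq0.
have sp' : (size (map_poly (fun c : F => c%:P%:F) p) <= n.+1)%N.
  by apply: leq_trans (size_poly _ _) sp.
rewrite /rf_eval (horner_coef_wide _ sp') rmorph_sum mulr_suml.
apply: eq_bigr => -[k /= ltkn] _.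
rewrite (coef_map (@tofrac {poly F} \o polyC)) /= -mul_polyC !tofracM !tofracXn.
rewrite expr_div_n -!mulrA; congr (_ * (_ * _)).
rewrite -[X in _ / _ ^+ X](subnKC (ltkn : (k <= n)%N)) exprD invfM mulrCA.
by rewrite divff ?expf_neq0 ?mulr1.
Qed.

Lemma rf_comp_frac n p q r s :
    q != 0 -> s != 0 -> coprimep p q ->
    (size p <= n.+1)%N -> (size q <= n.+1)%N ->
  rf_comp (p%:F / q%:F) (r%:F / s%:F) =
    (homog n p r s)%:F / (homog n q r s)%:F.
Proof.
move=> q0 s0 cpq sp sq; have [k k0 [np dq]] := rf_numden_frac q0 cpq.
rewrite /rf_comp np dq !(@rf_eval_frac n) ?size_scale // !homogZ.
have kF : k%:P%:F != 0 by rewrite tofrac_eq0 polyC_eq0.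
have sn0 : s%:F ^+ n != 0 by apply: expf_neq0; rewrite tofrac_eq0.
by rewrite (divf_cancelr _ _ sn0) -!mul_polyC !tofracM (divf_cancell _ _ kF).
Qed.

Lemma homog1 p r s : homog 1 p r s = p`_0 *: s + p`_1 *: r.
Proof. by rewrite /homog !big_ord_recl big_ord0 /=  !expr0 !expr1 mulr1 mul1r addr0. Qed.

Lemma homog2 p r s :
  homog 2 p r s = p`_0 *: s ^+ 2 + p`_1 *: (r * s) + p`_2 *: r ^+ 2.
Proof.
by rewrite /homog !big_ord_recl big_ord0 /= !expr0 !expr1 mulr1 mul1r addr0 addrA.
Qed.

Lemma size_exp_bound n m p : (size p <= m.+1)%N -> (size (p ^+ n) <= (n * m).+1)%N.
Proof.
move=> sp; apply: (leq_trans (size_poly_exp_leq _ _)).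
by rewrite ltnS mulnC leq_mul2l; apply/orP; right; lia.
Qed.

Lemma size_homog n m p r s :
  (size r <= m.+1)%N -> (size s <= m.+1)%N -> (size (homog n p r s) <= (n * m).+1)%N.
Proof.
move=> sr ss; apply: (leq_trans (size_sum _ _ _)); apply/bigmax_leqP => -[k /= lk] _.
apply: (leq_trans (size_scale_leq _ _)); apply: (leq_trans (size_polyMleq _ _)).
have := size_exp_bound k sr; have := size_exp_bound (n - k) ss.
by have := mulnDl k (n - k)%N m; rewrite (subnKC (lk : (k <= n)%N)); lia.
Qed.

Lemma coefM_top m n p q : (size p <= m.+1)%N -> (size q <= n.+1)%N ->
  (p * q)`_(m + n) = p`_m * q`_n.
Proof.
move=> sp sq; have mlt : (m < (m + n).+1)%N by rewrite ltnS leq_addr.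
rewrite coefM (bigD1 (Ordinal mlt)) //= addKn big1 ?addr0 // => -[i /= li] nei.
have {}nei : i <> m by move=> e; move: nei; rewrite -val_eqE /= e eqxx.
have [lti|lei] := ltnP i m.
  have sqi : (size q <= m + n - i)%N by apply: leq_trans sq _; lia.
  by rewrite (nth_default _ sqi) mulr0.
have spi : (size p <= i)%N by apply: leq_trans sp _; lia.
by rewrite (nth_default _ spi) mul0r.
Qed.

Lemma coefX_top m n p : (size p <= m.+1)%N -> (p ^+ n)`_(n * m) = p`_m ^+ n.
Proof.
move=> sp; elim: n => [|n IHn]; first by rewrite !expr0 coef1.
by rewrite !exprS mulSn coefM_top ?IHn ?size_exp_bound.
Qed.

Lemma coef_homog_top n m p r s :
    (size r <= m.+1)%N -> (size s <= m.+1)%N ->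
  (homog n p r s)`_(n * m) = \sum_(k < n.+1) p`_k * (r`_m ^+ k * s`_m ^+ (n - k)).
Proof.
move=> sr ss; rewrite coef_sum; apply: eq_bigr => -[k /= lk] _.
rewrite coefZ; congr (_ * _).
have -> : (n * m = k * m + (n - k) * m)%N by rewrite -mulnDl subnKC.
by rewrite coefM_top ?coefX_top ?size_exp_bound.
Qed.

Lemma horner_homog n p r s x :
  (homog n p r s).[x] = \sum_(k < n.+1) p`_k * (r.[x] ^+ k * s.[x] ^+ (n - k)).
Proof. by rewrite horner_sum; apply: eq_bigr => k _; rewrite !hornerE. Qed.

Lemma size_drop_top n p : (size p <= n.+1)%N -> p`_n = 0 -> (size p <= n)%N.
Proof.
move=> sp pn; have [//|ltnp] := leqP (size p) n.
have : lead_coef p = 0.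
  by rewrite lead_coefE (_ : size p = n.+1) //; apply/eqP; rewrite eqn_leq sp.
by move/eqP; rewrite lead_coef_eq0 => /eqP p0; move: ltnp; rewrite p0 size_poly0.
Qed.

Lemma coprimep_maxn_size_gt0 p q : coprimep p q -> (0 < maxn (size p) (size q))%N.
Proof.
rewrite leq_max !size_poly_gt0; have [->|//] := eqVneq p 0.
by apply: contraL => /eqP ->; rewrite coprimep0 -size_poly_eq1 size_poly0.
Qed.

(** For b nonzero the two forms are b^n p(a/b) and b^n q(a/b), so a common zero would give p and q a
    common root. For b = 0 only the terms in a^n remain, and one of their coefficients is nonzero
    because n is the exact maximal degree. *)
Lemma homog_common_zero n p q a b :
    coprimep p q -> (maxn (size p) (size q)).-1 = n ->
    \sum_(k < n.+1) p`_k * (a ^+ k * b ^+ (n - k)) = 0 ->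
    \sum_(k < n.+1) q`_k * (a ^+ k * b ^+ (n - k)) = 0 ->
  a = 0 /\ b = 0.
Proof.
move=> cpq nE.
have sp : (size p <= n.+1)%N by lia.
have sq : (size q <= n.+1)%N by lia.
have hb (u : {poly F}) : (size u <= n.+1)%N -> b != 0 ->
    \sum_(k < n.+1) u`_k * (a ^+ k * b ^+ (n - k)) = b ^+ n * u.[a / b].
  move=> su b0; rewrite (horner_coef_wide _ su) mulr_sumr; apply: eq_bigr => -[k /= lk] _.
  rewrite [RHS]mulrCA expr_div_n; congr (_ * _); rewrite [RHS]mulrCA; congr (_ * _).
  by rewrite -[X in _ = b ^+ X / _](subnK (lk : (k <= n)%N)) exprD mulfK ?expf_neq0.
have [->|b0] := eqVneq b 0; last first.
  rewrite !hb // => /eqP; rewrite mulf_eq0 expf_eq0 (negPf b0) andbF /= => /rootP rp.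
  move=> /eqP; rewrite mulf_eq0 expf_eq0 (negPf b0) andbF /= => rq.
  by move: (coprimep_root cpq (introT rootP rp)); rewrite rq.
(* As [0 ^+ 0] is 1, exactly the term k = n survives. *)
have h0 (u : {poly F}) : \sum_(k < n.+1) u`_k * (a ^+ k * 0 ^+ (n - k)) = u`_n * a ^+ n.
  rewrite big_ord_recr /= subnn expr0 mulr1 big1 ?add0r // => -[k /= lk] _.
  by rewrite [0 ^+ _]expr0n subn_eq0 leqNgt lk !mulr0.
rewrite !h0 => /eqP; rewrite mulf_eq0 => /orP[]; last first.
  by rewrite expf_eq0 => /andP[_ /eqP].
move=> /eqP pn /eqP; rewrite mulf_eq0 => /orP[]; last first.
  by rewrite expf_eq0 => /andP[_ /eqP].
move=> /eqP qn.
have := size_drop_top sp pn; have := size_drop_top sq qn.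
by have := coprimep_maxn_size_gt0 cpq; lia.
Qed.

End Fractions.

(** * Möbius transformations and rational functions of degree 1 *)

Section Mobius.
Variable F : fieldType.
Implicit Types (p q r s : {poly F}) (f g h : ratfun F) (a b c d : F).

Definition mobius a b c d : ratfun F :=
  (a *: 'X + b%:P)%:F / (c *: 'X + d%:P)%:F.

Lemma coef_linear a b : ((a *: 'X + b%:P)`_0 = b) * ((a *: 'X + b%:P)`_1 = a).
Proof. by rewrite !coefD !coefZ !coefX !coefC /= mulr0 add0r mulr1 addr0. Qed.

Lemma size_linear a b : (size (a *: 'X + b%:P)%R <= 2)%N.
Proof.
apply: (leq_trans (size_polyD _ _)); rewrite geq_max (leq_trans (size_scale_leq _ _)) ?size_polyX //.
by rewrite (leq_trans (size_polyC_leq1 _)).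
Qed.

Lemma linear_neq0 a b c d : a * d - b * c != 0 -> c *: 'X + d%:P != 0.
Proof.
apply: contra => /eqP e; have := coef_linear c d.
by rewrite e !coef0 => -[<- <-]; rewrite !mulr0 subr0.
Qed.

Lemma coprimep_linear a b c d : a * d - b * c != 0 ->
  coprimep (a *: 'X + b%:P) (c *: 'X + d%:P).
Proof.
move=> det0; apply/Bezout_eq1_coprimepP.
(* The multipliers -c and a eliminate X and leave the determinant, by which they are then
   divided. *)
exists ((- c / (a * d - b * c))%:P, (a / (a * d - b * c))%:P) => /=.
rewrite -!mul_polyC; transitivity (((a * d - b * c) / (a * d - b * c))%:P : {poly F}).
  by rewrite !polyCM !polyCB !polyCM !polyCN; ring.
by rewrite divff.
Qed.

Lemma rf_comp_mobius a b c d r s : a * d - b * c != 0 -> s != 0 ->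
  rf_comp (mobius a b c d) (r%:F / s%:F) = (a *: r + b *: s)%:F / (c *: r + d *: s)%:F.
Proof.
move=> det0 s0; rewrite (@rf_comp_frac F 1) ?size_linear ?(linear_neq0 det0) ?coprimep_linear //.
by rewrite !homog1 !coef_linear ![b *: _ + _]addrC ![d *: _ + _]addrC.
Qed.

Lemma mobius_comp_inverse a b c d : a * d - b * c != 0 ->
  rf_comp_inverse (mobius a b c d) (mobius d (- b) (- c) a).
Proof.
move=> det0; have det0' : d * a - - b * - c != 0 by rewrite mulrNN mulrC.
split; rewrite rf_comp_mobius ?(linear_neq0 det0) ?(linear_neq0 det0') //; last first.
- rewrite /rf_X -[RHS]divr1 -tofrac1; apply/eqP; rewrite tofrac_div_eq ?oner_neq0 //.
    by apply/eqP; rewrite -!mul_polyC !polyCN; ring.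
  rewrite (_ : _ + _ = (a * d - b * c)%:P) ?polyC_eq0 //.
  by rewrite -!mul_polyC !polyCB !polyCM !polyCN; ring.
rewrite /rf_X -[RHS]divr1 -tofrac1; apply/eqP; rewrite tofrac_div_eq ?oner_neq0 //.
  by apply/eqP; rewrite -!mul_polyC !polyCN; ring.
rewrite (_ : _ + _ = (a * d - b * c)%:P) ?polyC_eq0 //.
by rewrite -!mul_polyC !polyCB !polyCM !polyCN; ring.
Qed.

Lemma poly_size2 p : (size p <= 2)%N -> p = p`_1 *: 'X + (p`_0)%:P.
Proof.
move=> sp; apply/polyP => -[|[|i]]; rewrite ?coef_linear //.
have sp' : (size p <= i.+2)%N by apply: leq_trans sp _.
by rewrite (nth_default _ sp') nth_default // (leq_trans (size_linear _ _)).
Qed.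

Lemma rf_degree1P g : rf_degree g = 1%N ->
  exists a b c d, a * d - b * c != 0 /\ g = mobius a b c d.
Proof.
rewrite /rf_degree => dg; have cg := rf_coprime g; have dg0 := rf_den_neq0 g.
suff : exists a b c d,
    a * d - b * c != 0 /\ (rf_num g)%:F / (rf_den g)%:F = mobius a b c d.
  by rewrite -rf_numdenE.
move: (rf_num g) (rf_den g) dg dg0 cg => p q dg q0 cpq.
have /poly_size2 pE : (size p <= 2)%N by lia.
have /poly_size2 qE : (size q <= 2)%N by lia.
exists p`_1, p`_0, q`_1, q`_0; rewrite /mobius -pE -qE; split=> //.
move: dg q0 cpq; rewrite {}pE {}qE !coef_linear.
move: p`_1 p`_0 q`_1 q`_0 => a b c d dg q0 cpq.
(* With zero determinant, either c = 0 and both polynomials are constant, against degree 1, or -d/c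
   is a common root, against coprimality. *)
apply/eqP => /eqP; rewrite subr_eq0 => /eqP det0.
have [c0|c0] := eqVneq c 0.
  move: q0 det0 dg; rewrite c0 scale0r add0r polyC_eq0 mulr0 => d0 /eqP.
  rewrite mulf_eq0 (negPf d0) orbF => /eqP ->; rewrite scale0r add0r.
  by have := size_polyC_leq1 b; have := size_polyC_leq1 d; lia.
have rq : root (c *: 'X + d%:P) (- d / c).
  by apply/rootP; rewrite hornerD hornerZ hornerX hornerC mulrC divfK // addNr.
move: cpq; rewrite coprimep_sym => /coprimep_root/(_ rq)/eqP; apply.
rewrite hornerD hornerZ hornerX hornerC; apply: (mulIf c0); rewrite mulrDl -det0 mul0r.
by rewrite -mulrA divfK // mulrN addNr.
Qed.

End Mobius.

(** * Composition over an algebraically closed field: lowest terms and degrees *)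

Section ClosedField.
Variable F : closedFieldType.
Implicit Types (p q r s : {poly F}) (f g h : ratfun F).

(** Over a closed field coprimality means having no common root. At a common root x, the pair (r(x),
    s(x)) is a common zero of the two forms, hence (0, 0), so r and s would share the root x. *)
Lemma coprimep_homog n p q r s :
    coprimep p q -> (maxn (size p) (size q)).-1 = n -> coprimep r s ->
  coprimep (homog n p r s) (homog n q r s).
Proof.
move=> cpq nE crs; apply/Pdiv.ClosedField.coprimepP => x /rootP rP.
apply/eqP => rQ; move: rP rQ; rewrite !horner_homog.
move=> /(homog_common_zero cpq nE) h /h[/rootP rx sx].
by move: (coprimep_root crs rx); rewrite sx eqxx.
Qed.

(** The same argument at the point at infinity: the two coefficients of degree n m cannot both
    vanish. *)
Lemma maxn_size_homog n m p q r s :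
    coprimep p q -> (maxn (size p) (size q)).-1 = n ->
    coprimep r s -> (maxn (size r) (size s)).-1 = m ->
  maxn (size (homog n p r s)) (size (homog n q r s)) = (n * m).+1.
Proof.
move=> cpq nE crs mE.
have sr : (size r <= m.+1)%N by lia.
have ss : (size s <= m.+1)%N by lia.
apply/eqP; rewrite eqn_leq geq_max !size_homog //= ltnNge geq_max; apply/negP => /andP[lP lQ].
have := coef_homog_top n p sr ss; rewrite (nth_default _ lP) => /esym zP.
have := coef_homog_top n q sr ss; rewrite (nth_default _ lQ) => /esym zQ.
(* (r`_m, s`_m) is the value of (r, s) at infinity. *)
have [rm sm] := homog_common_zero cpq nE zP zQ.
have lr : (size r <= m)%N := size_drop_top sr rm.
have ls : (size s <= m)%N := size_drop_top ss sm.
by have rs : (0 < maxn (size r) (size s))%N := coprimep_maxn_size_gt0 crs; lia.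
Qed.

(** Both fractions are in lowest terms, so their equality becomes an equality of polynomials up to
    one scalar, and degrees multiply. *)
Lemma rf_comp_num_den (N D : {poly F}) g h (n := rf_degree g) :
    D != 0 -> coprimep N D -> (0 < (maxn (size N) (size D)).-1)%N ->
    N%:F / D%:F = rf_comp g h ->
  (maxn (size N) (size D)).-1 = (n * rf_degree h)%N /\
  exists2 k, k != 0 &
    N = k *: homog n (rf_num g) (rf_num h) (rf_den h) /\
    D = k *: homog n (rf_den g) (rf_num h) (rf_den h).
Proof.
move=> D0 cND deg_gt0.
have sgn : (size (rf_num g) <= n.+1)%N by rewrite /n /rf_degree; lia.
have sgd : (size (rf_den g) <= n.+1)%N by rewrite /n /rf_degree; lia.
rewrite [g in rf_comp g]rf_numdenE [h in rf_comp _ h]rf_numdenE.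
rewrite (@rf_comp_frac F n) ?rf_den_neq0 ?rf_coprime //.
set P := homog n _ _ _; set Q := homog n _ _ _ => ND.
have cPQ : coprimep P Q by apply: coprimep_homog; rewrite ?rf_coprime.
have sPQ : maxn (size P) (size Q) = (n * rf_degree h).+1.
  by apply: maxn_size_homog; rewrite ?rf_coprime.
have Q0 : Q != 0.
  (* If the composite did not exist, its conventional value 0 would force N = 0 and D constant,
     against the positive degree. *)
  apply/eqP => Q0; move: ND; rewrite Q0 tofrac0 invr0 mulr0 => /eqP.
  rewrite mulf_eq0 invr_eq0 !tofrac_eq0 (negPf D0) orbF => /eqP N0.
  move: cND deg_gt0; rewrite N0 coprime0p -size_poly_eq1 size_poly0 max0n => /eqP ->.
  by [].
have [k k0 [NE DE]] := coprimep_frac_uniq D0 Q0 cND cPQ ND.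
by split; last exists k; rewrite // NE DE !size_scale // sPQ.
Qed.

End ClosedField.

(** * Extension of scalars, and number fields of degree at most 3 *)

Lemma rf_map_frac (K L : fieldType) (phi : {rmorphism K -> L}) (p q : {poly K}) :
  q != 0 -> rf_map phi (p%:F / q%:F) = (map_poly phi p)%:F / (map_poly phi q)%:F.
Proof.
move=> q0; have := rf_numdenE (p%:F / q%:F); rewrite /rf_map.
have := rf_den_neq0 (p%:F / q%:F).
move: (rf_num _) (rf_den _) => u v v0 /eqP; rewrite tofrac_div_eq // => /eqP e.
by apply/eqP; rewrite tofrac_div_eq ?map_poly_eq0 // -!rmorphM /= e.
Qed.

(** The field is Q(z); its degree is that of the minimal polynomial of z, which divides m. *)
Lemma small_number_field (z : algC) (m : {poly rat}) :
    m != 0 -> (size m <= 4)%N -> root (map_poly ratr m) z ->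
  exists (K : fieldExtType rat) (iota : {rmorphism K -> algC}) (k : K),
    iota k = z /\ (\dim {:K} <= 3)%N.
Proof.
move=> m0 sm mz; have [K [iota [[|k [|? ?]] // [kz] gen]]] := num_field_exists [:: z].
exists K, iota, k; split=> //.
rewrite -gen adjoin_seq1 dim_Fadjoin dimv1 muln1 -ltnS -size_minPoly.
have mk : root (map_poly (in_alg K) m) k.
  rewrite -(fmorph_root iota) -map_poly_comp kz.
  rewrite (@eq_map_poly _ _ _ (ratr : rat -> algC)) // => x /=.
  by rewrite -(fmorph_eq_rat (iota \o in_alg K)).
apply: leq_trans (dvdp_leq _ (minPoly_dvdp _ mk)) _; rewrite ?map_poly_eq0 ?size_map_poly //.
exact: alg_polyOver.
Qed.

(** * Bases of a pencil of quadratic polynomials, and quadratic forms in them *)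

Section Quadratic.
Variable F : fieldType.
Implicit Types (p q r s G H T : {poly F}) (b c : F).

Lemma coef_poly3 (x0 x1 x2 : F) (p := x0%:P + x1%:P * 'X + x2%:P * 'X^2) :
  [/\ p`_0 = x0, p`_1 = x1 & p`_2 = x2].
Proof.
by split; rewrite /p !coefD !coefCM coefC coefX coefXn /= ?mulr0 ?mulr1 ?addr0 ?add0r.
Qed.

Lemma homog2_linear G (x y z t : F) H T :
  homog 2 (homog 2 G (x *: 'X + y%:P) (z *: 'X + t%:P)) H T =
  homog 2 G (x *: H + y *: T) (z *: H + t *: T).
Proof.
set R := homog 2 G (_ + _) _; rewrite [RHS]homog2.
move: (G`_0) (G`_1) (G`_2) (homog2 G (x *: 'X + y%:P) (z *: 'X + t%:P)) => g0 g1 g2.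
rewrite -/R -!mul_polyC => RE.
(* The coefficients of g0 (zX+t)^2 + g1 (xX+y)(zX+t) + g2 (xX+y)^2. *)
have [] := coef_poly3 (g0 * t ^+ 2 + g1 * y * t + g2 * y ^+ 2)
  (2 * g0 * z * t + g1 * (x * t + y * z) + 2 * g2 * x * y)
  (g0 * z ^+ 2 + g1 * x * z + g2 * x ^+ 2).
rewrite homog2 -!mul_polyC (_ : _ + _ + _ = R); last by rewrite RE; ring.
by move=> -> -> ->; ring.
Qed.

(** The matrix (x, y; z, t) takes (H, T) to the numerator and denominator of h; v is its Möbius
    transformation and u the inverse one. The scalar k is absorbed into R and S so that the forms
    can match numerator and denominator of f exactly. *)
Lemma quadratic_change_basis g h (x y z t k : F) H T :
    rf_degree g = 2%N -> x * t - y * z != 0 -> T != 0 -> k != 0 ->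
    rf_num h = x *: H + y *: T -> rf_den h = z *: H + t *: T ->
  exists u v R S,
   [/\ rf_unit u, rf_comp_inverse u v, rf_comp u h = H%:F / T%:F
     & rf_comp g v = R%:F / S%:F] /\
   [/\ (size R <= 3)%N, (size S <= 3)%N,
       k *: homog 2 (rf_num g) (rf_num h) (rf_den h) = homog 2 R H T
     & k *: homog 2 (rf_den g) (rf_num h) (rf_den h) = homog 2 S H T].
Proof.
move=> dg det0 T0 k0 hN hD.
have det0' : t * x - - y * - z != 0 by rewrite mulrNN [t * x]mulrC.
pose R p := k *: homog 2 p (x *: 'X + y%:P) (z *: 'X + t%:P).
exists (mobius t (- y) (- z) x), (mobius x y z t), (R (rf_num g)), (R (rf_den g)).
split; last first.
  have sR p : (size (R p) <= 3)%N.
    by rewrite size_scale // (size_homog 2 _ (size_linear _ _) (size_linear _ _)).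
  have hR p : homog 2 (R p) H T = k *: homog 2 p (rf_num h) (rf_den h).
    by rewrite homogZ homog2_linear hN hD.
  by split; rewrite ?sR ?hR.
have sgn : (size (rf_num g) <= 3)%N by move: dg; rewrite /rf_degree; lia.
have sgd : (size (rf_den g) <= 3)%N by move: dg; rewrite /rf_degree; lia.
split.
- by exists t, (- y), (- z), x.
- by have := mobius_comp_inverse det0'; rewrite !opprK.
- rewrite [h]rf_numdenE rf_comp_mobius ?rf_den_neq0 // hN hD.
  (* The adjugate matrix yields H and T multiplied by the determinant, which cancels. *)
  have det0P : (x * t - y * z)%:P%:F != 0 by rewrite tofrac_eq0 polyC_eq0.
  rewrite -[RHS](divf_cancell _ _ det0P) -!tofracM -!mul_polyC.
  congr (_%:F / _%:F); rewrite !polyCB !polyCM !polyCN; ring.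
- rewrite [g in rf_comp g]rf_numdenE (@rf_comp_frac F 2) ?(linear_neq0 det0) ?rf_den_neq0 ?rf_coprime //.
  have kP : k%:P%:F != 0 by rewrite tofrac_eq0 polyC_eq0.
  by rewrite -[LHS](divf_cancell _ _ kP) -!tofracM !mul_polyC.
Qed.

(* What the coefficients of a quadratic form in X^2 - c and X + b satisfy once
   the three coefficients of the form are eliminated. *)
Definition quad_rel b c p : Prop :=
  p`_1 = - c * p`_3 + 2 * b * p`_2 + 4 * b * c * p`_4 - 2 * b ^+ 2 * p`_3 /\
  p`_0 = c ^+ 2 * p`_4 - b * c * p`_3 + b ^+ 2 * (p`_2 + 2 * c * p`_4 - b * p`_3).

Lemma quad_relB b c p q (x y : F) :
  quad_rel b c p -> quad_rel b c q -> quad_rel b c (x *: p - y *: q).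
Proof.
by move=> [p1 p0] [q1 q0]; split; rewrite !coefB !coefZ ?p1 ?p0 ?q1 ?q0; ring.
Qed.

Lemma coef_poly5 (x0 x1 x2 x3 x4 : F)
    (p := x0%:P + x1%:P * 'X + x2%:P * 'X^2 + x3%:P * 'X^3 + x4%:P * 'X^4) :
  (p`_0 = x0) * (p`_1 = x1) * (p`_2 = x2) * (p`_3 = x3) * (p`_4 = x4).
Proof.
do 4?split; rewrite /p !coefD !coefCM coefC coefX !coefXn /=;
  by rewrite ?mulr0 ?mulr1 ?addr0 ?add0r.
Qed.

(** In the expansion, degrees 4, 3, 2 form a triangular system for the coefficients of R;
    substituting its solution in degrees 1 and 0 leaves [quad_rel]. *)
Lemma homog2_generic R b c (p := homog 2 R ('X^2 - c%:P) ('X + b%:P)) :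
  quad_rel b c p /\
  [/\ R`_2 = p`_4, R`_1 = p`_3 & R`_0 = p`_2 + 2 * c * p`_4 - b * p`_3].
Proof.
rewrite /p homog2; move: R`_0 R`_1 R`_2 => r0 r1 r2.
set q := _ + _.
have -> : q = (c ^+ 2 * r2 - b * c * r1 + b ^+ 2 * r0)%:P
  + (- c * r1 + 2 * b * r0)%:P * 'X + (- 2 * c * r2 + b * r1 + r0)%:P * 'X^2
  + r1%:P * 'X^3 + r2%:P * 'X^4.
  by rewrite /q -!mul_polyC; ring.
by rewrite /quad_rel !coef_poly5; do 2?split; ring.
Qed.

(** With T = 1 this is ordinary composition with X^2 + cX. The first relation expresses c through p
    as soon as p has degree 4. *)
Lemma homog2_additive R c (p := homog 2 R ('X^2 + c *: 'X) 1) :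
  [/\ p`_3 = 2 * c * p`_4, R`_2 = p`_4, R`_1 = p`_2 - c ^+ 2 * p`_4 & R`_0 = p`_0].
Proof.
rewrite /p homog2; move: R`_0 R`_1 R`_2 => r0 r1 r2.
set q := _ + _.
have -> : q = r0%:P + (c * r1)%:P * 'X + (c ^+ 2 * r2 + r1)%:P * 'X^2
  + (2 * c * r2)%:P * 'X^3 + r2%:P * 'X^4.
  by rewrite /q -!mul_polyC; ring.
by rewrite !coef_poly5; split; ring.
Qed.

Lemma poly_size3 p : (size p <= 3)%N ->
  p = (p`_0)%:P + (p`_1)%:P * 'X + (p`_2)%:P * 'X^2.
Proof.
move=> sp; apply/polyP => i; rewrite !coefD !coefCM coefC coefX coefXn.
case: i => [|[|[|i]]] /=; rewrite ?mulr0 ?mulr1 ?addr0 ?add0r //.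
by rewrite nth_default // (leq_trans sp).
Qed.

(** Row reduction of the 2 by 3 coefficient matrix. Since the degree is 2, the column of X^2 always
    contains a pivot; the two cases are the choices for the other one. *)
Lemma quadratic_normal_form p q :
    q != 0 -> coprimep p q -> (maxn (size p) (size q)).-1 = 2%N ->
  exists x y z t, x * t - y * z != 0 /\
    ((exists b c, p = x *: ('X^2 - c%:P) + y *: ('X + b%:P) /\
                  q = z *: ('X^2 - c%:P) + t *: ('X + b%:P)) \/
     (exists c, p = x *: ('X^2 + c *: 'X) + y *: 1 /\
                q = z *: ('X^2 + c *: 'X) + t *: 1)).
Proof.
move=> q0 cpq spq.
have sp : (size p <= 3)%N by lia.
have sq : (size q <= 3)%N by lia.
have pE := poly_size3 sp; have qE := poly_size3 sq.
have [a0|a0] := eqVneq (p`_2 * q`_1 - p`_1 * q`_2) 0; last first.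
  exists p`_2, p`_1, q`_2, q`_1; split=> //; left.
  (* Cramer's rule for the constant column in terms of the columns of X^2 and X. *)
  exists ((p`_2 * q`_0 - p`_0 * q`_2) / (p`_2 * q`_1 - p`_1 * q`_2)).
  exists ((p`_1 * q`_0 - p`_0 * q`_1) / (p`_2 * q`_1 - p`_1 * q`_2)).
  move: pE qE a0; move: p`_0 p`_1 p`_2 q`_0 q`_1 q`_2 => p0 p1 p2 q0' q1 q2 -> -> a0.
  set c := (p1 * _ - _) / _; set b := _ / _.
  have -> : p0 = p1 * b - p2 * c by rewrite /b /c; field.
  have -> : q0' = q1 * b - q2 * c by rewrite /b /c; field.
  by rewrite -!mul_polyC !polyCB !polyCM; split; ring.
have [b0|b0] := eqVneq (p`_2 * q`_0 - p`_0 * q`_2) 0; last first.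
  exists p`_2, p`_0, q`_2, q`_0; split=> //; right.
  exists ((p`_1 * q`_0 - p`_0 * q`_1) / (p`_2 * q`_0 - p`_0 * q`_2)).
  move: pE qE a0 b0; move: p`_0 p`_1 p`_2 q`_0 q`_1 q`_2 => p0 p1 p2 q0' q1 q2 -> -> a0 b0.
  set c := _ / _.
  (* The vanishing first minor makes the column of X equal to c times that of X^2. *)
  have -> : p1 = p2 * c.
    apply: (mulIf b0); rewrite /c mulrA divfK //; apply/eqP; rewrite -subr_eq0.
    by rewrite -(mulr0 p0) -a0; apply/eqP; ring.
  have -> : q1 = q2 * c.
    apply: (mulIf b0); rewrite /c mulrA divfK //; apply/eqP; rewrite -subr_eq0.
    by rewrite -(mulr0 q0') -a0; apply/eqP; ring.
  by rewrite -!mul_polyC !polyCM; split; ring.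
(* With both minors zero, p and q are proportional or both of degree less than 2. *)
exfalso; have e : q`_2 *: p = p`_2 *: q.
  rewrite [p in LHS]pE [q in RHS]qE -!mul_polyC; apply/eqP; rewrite -subr_eq0; apply/eqP.
  transitivity (- (p`_2 * q`_1 - p`_1 * q`_2)%:P * 'X
     - (p`_2 * q`_0 - p`_0 * q`_2)%:P : {poly F}); last by rewrite a0 b0; ring.
  ring.
have top (u : {poly F}) : u`_2 != 0 -> (2 < size u)%N.
  by move=> u2; rewrite ltnNge; apply: contra u2 => su; rewrite nth_default.
have [q2|q2] := eqVneq q`_2 0.
  move: e; rewrite q2 scale0r => /esym/eqP; rewrite scaler_eq0 (negPf q0) orbF => /eqP p2.
  by have := size_drop_top sp p2; have := size_drop_top sq q2; lia.
have pq : q %| p by rewrite -(dvdpZr _ _ q2) e -mul_polyC dvdp_mull.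
move: cpq; rewrite coprimep_sym => /coprimepP/(_ q (dvdpp q) pq).
by rewrite -size_poly_eq1 => /eqP sq1; have := top q q2; rewrite sq1.
Qed.
End Quadratic.

(** * The field generated by b and c *)

Lemma root_Poly_ratr (s : seq rat) (z : algC) :
  root (map_poly ratr (Poly s)) z = (horner_rec (map ratr s) z == 0).
Proof. by rewrite map_Poly ?rmorph0 // rootE horner_Poly. Qed.

Lemma ratr_lift (K : fieldExtType rat) (L : fieldType) (iota : {rmorphism K -> L}) (x : rat) :
  exists y, iota y = ratr x.
Proof. by exists (ratr x); rewrite fmorph_rat. Qed.

Lemma quad_rel_number_field (A E : {poly rat}) (b c : algC) :
    A`_4 != 0 -> E != 0 -> (size E <= 4)%N ->
    quad_rel b c (map_poly ratr A) -> quad_rel b c (map_poly ratr E) ->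
  exists (K : fieldExtType rat) (iota : {rmorphism K -> algC}) (b' c' : K),
    [/\ iota b' = b, iota c' = c & (\dim {:K} <= 3)%N].
Proof.
move=> A4 E0 sE; rewrite /quad_rel !coef_map /= => -[_ A0E] [E1E E0E].
have E4 : E`_4 = 0 by rewrite nth_default.
move: E1E E0E; rewrite E4 rmorph0 !mulr0 !addr0 => E1E E0E.
have nz (s : seq rat) i : s`_i != 0 -> Poly s != 0.
  by apply: contra => /eqP e; rewrite -coef_Poly e coef0.
have [E3|E3] := eqVneq E`_3 0; last first.
  have E3' : (ratr E`_3 : algC) != 0 by rewrite fmorph_eq0.
  (* E(-X), up to sign *)
  pose m := [:: - E`_0; E`_1; - E`_2; E`_3].
  have mb : root (map_poly ratr (Poly m)) b.
    by rewrite root_Poly_ratr /= !rmorphN /= E0E E1E; apply/eqP; ring.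
  have [K [iota [k [kb dK]]]] := small_number_field (nz m 3%N E3) (size_Poly _) mb.
  have [x xE] := ratr_lift iota (E`_2 / E`_3).
  have [y yE] := ratr_lift iota (E`_1 / E`_3).
  (* The relation for the coefficient of degree 1 of E, solved for c. *)
  exists K, iota, k, (2 * x * k - 2 * k ^+ 2 - y).
  split=> //; rewrite !(rmorphB, rmorphM, rmorphXn, rmorph_nat) kb xE yE !fmorph_div /= E1E.
  by field.
move: E1E E0E; rewrite E3 rmorph0 !mulr0 !subr0 add0r => E1E E0E.
(* Otherwise the relations would make the two lowest coefficients vanish as well, and E with
   them. *)
have E2 : E`_2 != 0.
  apply: contra E0 => /eqP E2; move: E1E E0E; rewrite E2 rmorph0 !mulr0 ?addr0.
  move=> /eqP; rewrite fmorph_eq0 => /eqP E1; move=> /eqP; rewrite fmorph_eq0 => /eqP Ez.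
  apply/eqP/polyP => i; rewrite coef0; case: i => [|[|[|[|i]]]] //.
  by rewrite nth_default // (leq_trans sE).
have E2' : (ratr E`_2 : algC) != 0 by rewrite fmorph_eq0.
have [r bE] : exists r, b = ratr r.
  exists (E`_1 / (2 * E`_2)); rewrite fmorph_div rmorphM rmorph_nat /= E1E.
  by field.
(* The relation for the constant coefficient of A, read as a quadratic equation in c with b = r. *)
pose m := [:: r ^+ 2 * A`_2 - r ^+ 3 * A`_3 - A`_0; 2 * r ^+ 2 * A`_4 - r * A`_3; A`_4].
have mc : root (map_poly ratr (Poly m)) c.
  rewrite root_Poly_ratr /=; apply/eqP.
  rewrite !(rmorphB, rmorphM, rmorphXn, rmorph_nat) /= A0E -bE; ring.
have sm : (size (Poly m) <= 4)%N by apply: leq_trans (size_Poly _) _.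
have [K [iota [k [kc dK]]]] := small_number_field (nz m 2%N A4) sm mc.
by exists K, iota, (ratr r), k; rewrite fmorph_rat.
Qed.

Lemma quad_rel_pair_number_field (p q : {poly rat}) (b c : algC) :
    coprimep p q -> (size p <= 5)%N -> (size q <= 5)%N -> p`_4 != 0 ->
    quad_rel b c (map_poly ratr p) -> quad_rel b c (map_poly ratr q) ->
  exists (K : fieldExtType rat) (iota : {rmorphism K -> algC}) (b' c' : K),
    [/\ iota b' = b, iota c' = c & (\dim {:K} <= 3)%N].
Proof.
move=> cpq sp sq p4 rp rq.
apply: (@quad_rel_number_field p (p`_4 *: q - q`_4 *: p)) => //.
(* If the combination that cancels degree 4 were zero, p would divide q and, being coprime to it, be
   constant. *)
- apply/eqP => /subr0_eq e; have pq : p %| q.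
    by rewrite -(dvdpZr _ _ p4) e -mul_polyC dvdp_mull.
  move/coprimepP: cpq => /(_ p (dvdpp p) pq); rewrite -size_poly_eq1 => /eqP sp1.
  by move: p4; rewrite nth_default ?eqxx // sp1.
- apply: size_drop_top; last by rewrite coefB !coefZ mulrC subrr.
  rewrite (leq_trans (size_polyD _ _)) // geq_max size_polyN.
  by rewrite !(leq_trans (size_scale_leq _ _)).
- by rewrite rmorphB /= !map_polyZ; apply: quad_relB.
Qed.

(** * Descent of polynomials and rational functions to a number field *)

Lemma map_poly3 (K L : fieldType) (iota : {rmorphism K -> L}) (R : {poly L}) (x0 x1 x2 : K) :
    (size R <= 3)%N -> iota x0 = R`_0 -> iota x1 = R`_1 -> iota x2 = R`_2 ->
  R = map_poly iota (x0%:P + x1%:P * 'X + x2%:P * 'X^2).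
Proof.
move=> sR e0 e1 e2; rewrite {1}(poly_size3 sR) -e0 -e1 -e2.
by rewrite !rmorphD !rmorphM /= !map_polyC !map_polyX.
Qed.

Lemma rf_defined_over_frac (K L : fieldType) (iota : {rmorphism K -> L}) (p q : {poly K}) :
  map_poly iota q != 0 ->
  rf_defined_over iota ((map_poly iota p)%:F / (map_poly iota q)%:F).
Proof.
by rewrite map_poly_eq0 => q0; exists (p%:F / q%:F); rewrite rf_map_frac.
Qed.

Lemma rf_defined_over_rat (K : fieldExtType rat) (iota : {rmorphism K -> algC})
    (f : ratfun rat) :
  rf_defined_over iota (rf_map (ratr : rat -> algC) f).
Proof.
have ratrE (p : {poly rat}) : map_poly ratr p = map_poly iota (map_poly (in_alg K) p).
  rewrite -map_poly_comp; apply: eq_map_poly => x /=.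
  by rewrite -(fmorph_eq_rat (iota \o in_alg K)).
rewrite /rf_map !ratrE; apply: rf_defined_over_frac.
by rewrite !map_poly_eq0 rf_den_neq0.
Qed.

Lemma trivial_number_field :
  exists (K : fieldExtType rat) (iota : {rmorphism K -> algC}), (\dim {:K} <= 3)%N.
Proof.
have X0 : root (map_poly ratr 'X) (0 : algC) by rewrite map_polyX rootX.
have [||K [iota [_ [_ dK]]]] := small_number_field _ _ X0; rewrite ?size_polyX ?polyX_eq0 //.
by exists K, iota.
Qed.

(** * The decomposition, by the degrees of g and h *)

Theorem theorem11 (f : ratfun rat) (g h : ratfun algC) :
  rf_degree f = 4%N ->
  rf_map (ratr : rat -> algC) f = rf_comp g h ->
  exists (K : fieldExtType rat) (iota : {rmorphism K -> algC})
         (u v : ratfun algC),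
    [/\ rf_unit u,
        rf_comp_inverse u v,
        rf_defined_over iota (rf_comp g v),
        rf_defined_over iota (rf_comp u h)
      & (\dim {:K} <= 3)%N].
Proof.
move=> df fgh.
pose N := rf_num f; pose D := rf_den f.
have D0 : map_poly (ratr : rat -> algC) D != 0 by rewrite map_poly_eq0 rf_den_neq0.
have cND : coprimep (map_poly (ratr : rat -> algC) N) (map_poly ratr D).
  by rewrite coprimep_map rf_coprime.
have sND : (maxn (size (map_poly (ratr : rat -> algC) N))
                 (size (map_poly (ratr : rat -> algC) D))).-1 = 4%N.
  by rewrite !size_map_poly.
have := rf_comp_num_den D0 cND _ fgh; rewrite sND => /(_ isT).
move=> [dgh [k k0 [NE DE]]].
have Xdef (K : fieldExtType rat) (iota : {rmorphism K -> algC}) :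
    rf_defined_over iota (rf_X : ratfun algC).
  have := @rf_defined_over_frac _ _ iota 'X 1.
  by rewrite map_polyX rmorph1 oner_neq0 tofrac1 divr1; apply.
have : (rf_degree g = 1 \/ rf_degree h = 1 \/ (rf_degree g = 2 /\ rf_degree h = 2))%N.
  move: dgh; move: (rf_degree g) (rf_degree h) => [|[|[|[|[|n]]]]] [|[|[|m]]]; lia.
case=> [|[|[dg dh]]].
(* With u = g, the left factor becomes X and the right one f. *)
- move=> /rf_degree1P [x [y [z [t [det0 gE]]]]].
  have [K [iota dK]] := trivial_number_field.
  have [gv vg] := mobius_comp_inverse det0.
  exists K, iota, g, (mobius t (- y) (- z) x); split=> //; rewrite ?gE //.
  + by exists x, y, z, t.
  + by rewrite gv.
  + by rewrite -gE -fgh; apply: rf_defined_over_rat.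
(* With v = h, the left factor becomes f and the right one X. *)
- move=> /rf_degree1P [x [y [z [t [det0 hE]]]]].
  have [K [iota dK]] := trivial_number_field.
  have [gv vg] := mobius_comp_inverse det0.
  exists K, iota, (mobius t (- y) (- z) x), h; split=> //; rewrite ?hE //.
  + exists t, (- y), (- z), x; split=> //.
    by rewrite mulrNN [t * x]mulrC.
  + by rewrite -hE -fgh; apply: rf_defined_over_rat.
  + by rewrite vg.
have [x [y [z [t [det0]]]]] :=
  quadratic_normal_form (rf_den_neq0 h) (rf_coprime h) dh.
have S0 (T : {poly algC}) H S : homog 2 S H T = map_poly ratr D -> S != 0.
  move=> e; apply: contra D0 => /eqP S0; rewrite -e S0 homog2 !coef0 !scale0r !addr0 //.
(* Whichever of N and D has degree 4 is used to cancel the top term of the other. *)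
have top : N`_4 != 0 \/ D`_4 != 0.
  have [N4|] := eqVneq N`_4 0; last by left.
  right; apply/eqP => D4; move: df; rewrite /rf_degree -/N -/D => df.
  have sN : (size N <= 5)%N by lia.
  have sD : (size D <= 5)%N by lia.
  by have := size_drop_top sN N4; have := size_drop_top sD D4; lia.
rewrite dg in NE DE.
case=> [[b [c [hN hD]]] | [c [hN hD]]].
- have T0 : 'X + b%:P != 0 by rewrite -size_poly_eq0 size_XaddC.
  have [u [v [R [S [[uu uv uh gv] [sR sS]]]]]] :=
    quadratic_change_basis dg det0 T0 k0 hN hD.
  rewrite -NE -DE => NR DS.
  have [] := homog2_generic R b c; rewrite -NR => qN [R2 R1 R0].
  have [] := homog2_generic S b c; rewrite -DS => qD [S2 S1 Sz].
  have [K [iota [b' [c' [b'b c'c dK]]]]] : exists (K : fieldExtType rat)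
      (iota : {rmorphism K -> algC}) (b' c' : K),
      [/\ iota b' = b, iota c' = c & (\dim {:K} <= 3)%N].
    have cND' : coprimep N D by rewrite rf_coprime.
    have sN : (size N <= 5)%N by move: df; rewrite /rf_degree -/N -/D; lia.
    have sD : (size D <= 5)%N by move: df; rewrite /rf_degree -/N -/D; lia.
    case: top => [N4|D4]; first exact: quad_rel_pair_number_field cND' sN sD N4 qN qD.
    by apply: quad_rel_pair_number_field D4 qD qN; rewrite // coprimep_sym.
  exists K, iota, u, v; split=> //.
  + have := S0 _ _ _ (esym DS); rewrite gv.
    (* The coefficients of R and S are polynomials in b, c and rational numbers, so both forms lift
       to K. *)
    have mapR (p : {poly rat}) (P : {poly algC}) : (size P <= 3)%N ->
        P`_2 = (map_poly ratr p)`_4 -> P`_1 = (map_poly ratr p)`_3 ->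
        P`_0 = (map_poly ratr p)`_2 + 2 * c * (map_poly ratr p)`_4 - b * (map_poly ratr p)`_3 ->
        exists P' : {poly K}, P = map_poly iota P'.
      rewrite !coef_map /= => sP P2 P1 P0.
      have [p2 p2E] := ratr_lift iota p`_2; have [p3 p3E] := ratr_lift iota p`_3.
      have [p4 p4E] := ratr_lift iota p`_4.
      exists ((p2 + 2 * c' * p4 - b' * p3)%:P + p3%:P * 'X + p4%:P * 'X^2).
      apply: map_poly3 => //; rewrite ?P0 ?P1 ?P2 //.
      by rewrite !(rmorphB, rmorphD, rmorphM, rmorph_nat) /= p2E p3E p4E b'b c'c; ring.
    have [R' ->] := mapR N R sR R2 R1 R0.
    have [S' ->] := mapR D S sS S2 S1 Sz.
    exact: rf_defined_over_frac.
  + rewrite uh.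
    have <- : map_poly iota ('X^2 - c'%:P) = 'X^2 - c%:P.
      by rewrite rmorphB /= map_polyXn map_polyC /= c'c.
    have TE : map_poly iota ('X + b'%:P) = 'X + b%:P.
      by rewrite rmorphD /= map_polyX map_polyC /= b'b.
    by rewrite -TE; apply: rf_defined_over_frac; rewrite TE.
- have [u [v [R [S [[uu uv uh gv] [sR sS]]]]]] :=
    quadratic_change_basis dg det0 (oner_neq0 _) k0 hN hD.
  rewrite -NE -DE => NR DS.
  have := homog2_additive R c; rewrite -NR => -[N3 R2 R1 R0].
  have := homog2_additive S c; rewrite -DS => -[D3 S2 S1 Sz].
  have [r cr] : exists r : rat, c = ratr r.
    (* The coefficients of degrees 3 and 4 of N or D already determine c, so any number field
       serves. *)
    have rat_coef (p : {poly rat}) : p`_4 != 0 ->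
        (map_poly ratr p)`_3 = 2 * c * (map_poly ratr p)`_4 -> exists r : rat, c = ratr r.
      rewrite !coef_map /= => p4 p3; exists (p`_3 / (2 * p`_4)).
      have p4' : (ratr p`_4 : algC) != 0 by rewrite fmorph_eq0.
      by rewrite fmorph_div rmorphM rmorph_nat /= p3; field.
    by case: top => /rat_coef; apply.
  have [K [iota dK]] := trivial_number_field.
  have [c' c'c] := ratr_lift iota r; rewrite -cr in c'c.
  exists K, iota, u, v; split=> //.
  + have := S0 _ _ _ (esym DS); rewrite gv.
    have mapR (p : {poly rat}) (P : {poly algC}) : (size P <= 3)%N ->
        P`_2 = (map_poly ratr p)`_4 ->
        P`_1 = (map_poly ratr p)`_2 - c ^+ 2 * (map_poly ratr p)`_4 ->
        P`_0 = (map_poly ratr p)`_0 ->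
        exists P' : {poly K}, P = map_poly iota P'.
      rewrite !coef_map /= => sP P2 P1 P0.
      have [p0 p0E] := ratr_lift iota p`_0; have [p2 p2E] := ratr_lift iota p`_2.
      have [p4 p4E] := ratr_lift iota p`_4.
      exists (p0%:P + (p2 - c' ^+ 2 * p4)%:P * 'X + p4%:P * 'X^2).
      apply: map_poly3 => //; rewrite ?P0 ?P1 ?P2 //.
      by rewrite !(rmorphB, rmorphXn, rmorphM) /= p2E p4E c'c.
    have [R' ->] := mapR N R sR R2 R1 R0.
    have [S' ->] := mapR D S sS S2 S1 Sz.
    exact: rf_defined_over_frac.
  + rewrite uh.
    have <- : map_poly iota ('X^2 + c' *: 'X) = 'X^2 + c *: 'X.
      by rewrite rmorphD /= map_polyXn map_polyZ map_polyX /= c'c.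
    rewrite -(rmorph1 (map_poly iota)); apply: rf_defined_over_frac.
    by rewrite rmorph1 oner_neq0.
Qed.
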